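(* Let $\Gamma$ and $\Lambda$ be categories and let $R$ be a ring equipped with a nonzero strong $\Gamma$-grading $(V_s)_{s\in\mathrm{mor}(\Gamma)}$. (a) There is a bijection between the set of elementary $\Lambda$-gradings on $R$ and the set of prefunctors from $\Gamma$ to $\Lambda$. (b) If $\Lambda$ has the property that for each $e\in\mathrm{ob}(\Lambda)$ the only idempotent of $\Lambda_e$ is the identity morphism of $e$, then there is a bijection between the set of elementary $\Lambda$-gradings on $R$ and the set of functors from $\Gamma$ to $\Lambda$. This last conclusion holds in particular if $\Lambda$ is a groupoid.
   Context: For a category $\Gamma$, $d(s)$ and $c(s)$ denote the domain and codomain of a morphism $s$, and $\Gamma_e$ denotes the monoid of morphisms $e\to e$ for an object $e$. A groupoid is a category in which all morphisms are isomorphisms. A prefunctor between categories is defined exactly as a functor except that it does not necessarily respect identity morphisms. Let $R$ be an associative ring. A $\Gamma$-filter on $R$ is a family $(V_s)_{s \in \mathrm{mor}(\Gamma)}$ of additive subgroups of $R$ such that for all $s,t \in \mathrm{mor}(\Gamma)$: $V_sV_t\subseteq V_{st}$ if $(s,t)$ is composable (i.e. $d(s)=c(t)$), and $V_sV_t=\{0\}$ otherwise (where $V_sV_t$ is the additive subgroup generated by products). It is nonzero if $V_s\ne\{0\}$ for all $s \in \mathrm{mor}(\Gamma)$, and strong if $V_sV_t=V_{st}$ for all composable pairs $(s,t)$. It is a $\Gamma$-grading if $R=\bigoplus_{s\in\mathrm{mor}(\Gamma)}V_s$; a grading is nonzero (strong) if it is so as a filter. Given the $\Gamma$-grading $(V_s)$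 on $R$, a $\Lambda$-filter (in particular a $\Lambda$-grading) $(W_t)_{t\in\mathrm{mor}(\Lambda)}$ on $R$ is elementary if $W_t=\sum_{V_s\subseteq W_t}V_s$ (sum over $s \in \mathrm{mor}(\Gamma)$ with $V_s\subseteq W_t$) for all $t\in\mathrm{mor}(\Lambda)$. *)

(* Defs.v *)
From HB Require Import structures.
From mathcomp Require Import all_boot all_order all_algebra.
From mathcomp Require Import boolp classical_sets functions cardinality fsbigop.

Set Implicit Arguments.
Unset Strict Implicit.
Unset Printing Implicit Defensive.

Import GRing.Theory.

Local Open Scope classical_set_scope.
Local Open Scope ring_scope.

(* [comp s t st] is the composite "s after t".  As [comp] takes a proof of
   composability, the laws below are stated for all such proofs. *)
Record category := Category {
  ob : Type;
  mor : Type;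
  dom : mor -> ob;
  cod : mor -> ob;
  idm : ob -> mor;
  comp : forall s t : mor, dom s = cod t -> mor;
  dom_idm : forall e, dom (idm e) = e;
  cod_idm : forall e, cod (idm e) = e;
  dom_comp : forall s t (st : dom s = cod t), dom (comp st) = dom t;
  cod_comp : forall s t (st : dom s = cod t), cod (comp st) = cod s;
  comp_idr : forall s (h : dom s = cod (idm (dom s))), comp h = s;
  comp_idl : forall s (h : dom (idm (cod s)) = cod s), comp h = s;
  compA : forall r s t (rs : dom r = cod s) (st : dom s = cod t)
    (h1 : dom (comp rs) = cod t) (h2 : dom r = cod (comp st)),
    comp h1 = comp h2
}.

Arguments idm {c} e.

Definition isomorphism (C : category) (s : mor C) : Prop :=
  exists (t : mor C) (st : dom s = cod t) (ts : dom t = cod s),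
    comp st = idm (cod s) /\ comp ts = idm (dom s).

Definition groupoid (C : category) : Prop :=
  forall s : mor C, isomorphism s.

Definition only_trivial_idempotents (C : category) : Prop :=
  forall (e : ob C) (s : mor C) (ds : dom s = e) (cs : cod s = e),
    comp (etrans ds (esym cs)) = s -> s = idm e.

(* The proof [fst] in [pcomp] always exists, by [pdom] and [pcod]. *)
Record prefunctor (C D : category) := Prefunctor {
  pob : ob C -> ob D;
  pmor : mor C -> mor D;
  pdom : forall s, dom (pmor s) = pob (dom s);
  pcod : forall s, cod (pmor s) = pob (cod s);
  pcomp : forall s t (st : dom s = cod t)
    (fst : dom (pmor s) = cod (pmor t)), pmor (comp st) = comp fst
}.

Record functor (C D : category) := Functor {
  functor_prefunctor :> prefunctor C D;
  functor_id : forall e, pmor functor_prefunctor (idm e) =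
                         idm (pob functor_prefunctor e)
}.

(* Associative rings without a unit requirement: MathComp's ring structures all
   have a unit, which a ring with a nonzero strong grading by a category with
   infinitely many objects never has.  The product is [x ** y], as [*] in
   [ring_scope] belongs to the unital structures. *)
HB.mixin Record Zmodule_isAssocRing R of GRing.Zmodule R := {
  rmul : R -> R -> R;
  rmulA : associative rmul;
  rmulDl : left_distributive rmul +%R;
  rmulDr : right_distributive rmul +%R
}.

#[short(type="assocRingType")]
HB.structure Definition AssocRing :=
  { R of Zmodule_isAssocRing R & GRing.Zmodule R }.

Notation "x ** y" := (rmul x y) (at level 40, left associativity) : ring_scope.

Definition additive_subgroup (R : zmodType) (A : set R) : Prop :=
  A 0 /\ (forall x y, A x -> A y -> A (x - y)).

Definition subgroup_mul (R : assocRingType) (A B : set R) : set R :=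
  smallest (@additive_subgroup R) [set x ** y | x in A & y in B].

Definition subgroup_sum (R : zmodType) (I : Type) (P : set I)
    (V : I -> set R) : set R :=
  smallest (@additive_subgroup R) (\bigcup_(i in P) V i).

(* Finiteness of the support is required explicitly because [\sum_(i \in _) f i]
   is 0 by convention when the support is infinite. *)
Definition internal_direct_sum (R : zmodType) (I : Type)
    (V : I -> set R) : Prop :=
  forall x : R, exists! f : I -> R,
    [/\ forall i, V i (f i),
        finite_set [set i | f i != 0] &
        x = \sum_(i \in [set: {classic I}]) f i].

Section Filters.
Variables (R : assocRingType) (C : category).
Implicit Type V : mor C -> set R.

Definition is_filter V : Prop :=
  [/\ forall s, additive_subgroup (V s),
      forall s t (st : dom s = cod t),
        subgroup_mul (V s) (V t) `<=` V (comp st) &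
      forall s t, dom s <> cod t -> subgroup_mul (V s) (V t) = [set 0]].

Definition nonzero_filter V : Prop := forall s, V s <> [set 0].

Definition strong_filter V : Prop :=
  forall s t (st : dom s = cod t), subgroup_mul (V s) (V t) = V (comp st).

Definition is_grading V : Prop := is_filter V /\ internal_direct_sum V.

End Filters.

Definition elementary (R : assocRingType) (C D : category)
    (V : mor C -> set R) (W : mor D -> set R) : Prop :=
  forall t, W t = subgroup_sum [set s | V s `<=` W t] V.

Definition elementary_grading (R : assocRingType) (C : category)
    (V : mor C -> set R) (D : category) : Type :=
  {W : mor D -> set R | is_grading W /\ elementary V W}.

(* Main.v *)
(* A prefunctor F corresponds to the family W_t = sum of the V_s with F s = t.
   Conversely, if W is an elementary grading, every V_s lies in some W_t, for
   otherwise the projection onto V_s would kill all the W_t; this t is unique as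
   V_s is nonzero.  Call it F s.  When s and t are composable,
   V_(st) = V_s V_t is nonzero and lies in W_(F s) W_(F t), so F s and F t are
   composable and F (st) = (F s)(F t).  The image of an identity under a
   prefunctor is an idempotent, whence the second part. *)
From mathcomp Require Import all_boot all_order all_algebra.
From mathcomp Require Import finmap boolp classical_sets cardinality fsbigop.
Require Import Defs.

Set Implicit Arguments.
Unset Strict Implicit.
Unset Printing Implicit Defensive.

Import GRing.Theory.

Local Open Scope classical_set_scope.
Local Open Scope ring_scope.

(** * Generated additive subgroups and their products *)

Lemma smallest_subgroup (R : zmodType) (G : set R) :
  additive_subgroup (smallest (@additive_subgroup R) G).
Proof.
split=> [B [[B0 _] _]//|x y Gx Gy B /[dup] BG [[_ subB] _]].
by apply: subB; [exact: Gx | exact: Gy].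
Qed.

Lemma subgroup_sum_subgroup (R : zmodType) (I : Type) (P : set I)
    (V : I -> set R) : additive_subgroup (subgroup_sum P V).
Proof. exact: smallest_subgroup. Qed.

Lemma subgroup_mul_subgroup (R : assocRingType) (A B : set R) :
  additive_subgroup (subgroup_mul A B).
Proof. exact: smallest_subgroup. Qed.

Lemma sub_subgroup_sum (R : zmodType) (I : Type) (P : set I)
    (V : I -> set R) (i : I) : P i -> V i `<=` subgroup_sum P V.
Proof. by move=> Pi x Vx; apply: sub_gen_smallest; exists i. Qed.

Lemma subgroup_sum_sub (R : zmodType) (I : Type) (P : set I)
    (V : I -> set R) (B : set R) :
  additive_subgroup B -> (forall i, P i -> V i `<=` B) -> subgroup_sum P V `<=` B.
Proof. by move=> sB VB; apply: smallest_sub => // x [i Pi Vx]; exact: VB Vx. Qed.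

Lemma mem_subgroup_mul (R : assocRingType) (A B : set R) (x y : R) :
  A x -> B y -> subgroup_mul A B (x ** y).
Proof. by move=> Ax By; apply: sub_gen_smallest; exists x => //; exists y. Qed.

Lemma subgroup_mul_sub (R : assocRingType) (A B C : set R) :
  additive_subgroup C -> (forall x y, A x -> B y -> C (x ** y)) ->
  subgroup_mul A B `<=` C.
Proof. by move=> sC ABC; apply: smallest_sub => // z [x Ax [y By <-]]; exact: ABC. Qed.

Lemma rmul0l (R : assocRingType) (x : R) : 0 ** x = 0.
Proof. by apply: (addrI (0 ** x)); rewrite -rmulDl !addr0. Qed.

Lemma rmul0r (R : assocRingType) (x : R) : x ** 0 = 0.
Proof. by apply: (addrI (x ** 0)); rewrite -rmulDr !addr0. Qed.

Lemma rmulNl (R : assocRingType) (x y : R) : (- x) ** y = - (x ** y).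
Proof. by apply: (addrI (x ** y)); rewrite -rmulDl !subrr rmul0l. Qed.

Lemma rmulNr (R : assocRingType) (x y : R) : x ** (- y) = - (x ** y).
Proof. by apply: (addrI (x ** y)); rewrite -rmulDr !subrr rmul0r. Qed.

(** Distributivity allows one induction on generation per factor: for fixed [y] the [x] with
    [x ** y] in [B] form a subgroup, and likewise for fixed [x]. *)
Lemma subgroup_sum_rmul (R : assocRingType) (I J : Type) (P : set I) (Q : set J)
    (V : I -> set R) (W : J -> set R) (B : set R) :
  additive_subgroup B ->
  (forall i j x y, P i -> Q j -> V i x -> W j y -> B (x ** y)) ->
  forall x y, subgroup_sum P V x -> subgroup_sum Q W y -> B (x ** y).
Proof.
move=> [B0 sB] VWB x y Px Qy.
move: x Px; apply: subgroup_sum_sub.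
  by split=> [|u v]; rewrite ?rmul0l // rmulDl rmulNl => Bu Bv; exact: sB.
move=> i Pi x Vx.
move: y Qy; apply: (@subgroup_sum_sub _ _ _ _ [set y | B (x ** y)]).
  by split=> [|u v] /=; rewrite ?rmul0r // rmulDr rmulNr => Bu Bv; exact: sB.
by move=> j Qj y Wy; exact: VWB Vx Wy.
Qed.

(** * Decompositions along a family of subgroups and their projections *)

Definition decomposes (R : zmodType) (I : Type) (V : I -> set R) (x : R)
    (f : I -> R) : Prop :=
  [/\ forall i, V i (f i), finite_set [set i | f i != 0]
    & x = \sum_(i \in [set: {classic I}]) f i].

(** Any finite set containing the support serves, so that sums with different supports can be taken
    over one common set. *)
Lemma fsum_finite_support (R : zmodType) (I : Type) (f : I -> R)
    (A : {fset {classic I}}) :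
  (forall i : {classic I}, f i != 0 -> i \in A) ->
  \sum_(i \in [set: {classic I}]) f i = \sum_(i <- A) f i.
Proof.
by move=> fA; apply: fsbigTE => i; apply: contraNeq => /fA.
Qed.

Lemma decomposesB (R : zmodType) (I : Type) (V : I -> set R)
    (hV : forall i, additive_subgroup (V i)) (x y : R) (f g : I -> R) :
  decomposes V x f -> decomposes V y g ->
  decomposes V (x - y) (fun i => f i - g i).
Proof.
move=> [Vf ff xE] [Vg fg yE].
have /(@finite_fsetP {classic I}) [A AE] :
  finite_set ([set i | f i != 0] `|` [set i | g i != 0]).
  by rewrite finite_setU.
have fA i : f i != 0 -> i \in A.
  by move=> fi; rewrite -/([set` A] i) -AE; left.
have gA i : g i != 0 -> i \in A.
  by move=> gi; rewrite -/([set` A] i) -AE; right.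
have fgA i : f i - g i != 0 -> i \in A.
  apply: contraNT => iA.
  have [/eqP-> /eqP->] : f i == 0 /\ g i == 0.
    by split; apply: contraNT iA; auto.
  by rewrite subrr.
split=> [i||]; first by case: (hV i) => _; exact.
  by apply: (@sub_finite_set _ _ [set` A]) => //=; exact: finite_fset.
by rewrite xE yE !(fsum_finite_support (A := A)) // sumrB.
Qed.

Lemma decomposes_single (R : zmodType) (I : Type) (V : I -> set R)
    (hV : forall i, additive_subgroup (V i)) (i : I) (x : R) :
  V i x -> decomposes V x (fun j => if `[< j = i >] then x else 0).
Proof.
move=> Vx; split=> [j||].
- by case: asboolP => [->//|_]; case: (hV j).
- apply: (@sub_finite_set _ _ [set i]) => [j /=|]; last exact: finite_set1.
  by case: asboolP => // _; rewrite eqxx.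
- rewrite (fsum_finite_support (A := [fset (i : {classic I})]%fset)) => [|j].
    by rewrite big_seq_fset1; case: asboolP.
  by rewrite inE; case: asboolP => [->|_]; rewrite eqxx.
Qed.

Lemma direct_sum_generates (R : zmodType) (I : Type) (V : I -> set R) :
  internal_direct_sum V -> forall x, subgroup_sum [set: I] V x.
Proof.
move=> dV x; have [f [[Vf _ ->] _]] := dV x.
have [S0 SB] := subgroup_sum_subgroup [set: I] V.
apply: (big_ind (subgroup_sum [set: I] V)) => // [u v Su Sv|i _].
  (* Only closure under subtraction is given, so [u + v] is read as [u - (0 - v)]. *)
  by rewrite -[v]opprK; apply: (SB) => //; rewrite -sub0r; exact: SB.
exact: sub_subgroup_sum (Vf i).
Qed.

(** The elements that have a decomposition form a subgroup containing every [V i]. *)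
Lemma subgroup_sum_decomposes (R : zmodType) (I : Type) (V : I -> set R)
    (hV : forall i, additive_subgroup (V i)) :
  forall x, subgroup_sum [set: I] V x -> exists f, decomposes V x f.
Proof.
apply: subgroup_sum_sub => [|i _ x Vx]; last first.
  by exists (fun j => if `[< j = i >] then x else 0); exact: decomposes_single.
split=> [|x y [f fx] [g gy]]; last by exists (fun i => f i - g i); exact: decomposesB.
exists (fun=> 0); split=> [i||]; first by case: (hV i).
- by apply: (@sub_finite_set _ _ set0) => // i /=; rewrite eqxx.
- by rewrite fsbig1.
Qed.

(* The uniqueness in [internal_direct_sum] amounts to additive projections that
   are jointly injective; with these no double sum has to be rearranged. *)
Record direct_projections (R : zmodType) (I : Type) (V : I -> set R)
    (p : I -> R -> R) : Prop := DirectProjections {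
  projB : forall i x y, p i (x - y) = p i x - p i y;
  proj_id : forall i x, V i x -> p i x = x;
  proj_other : forall i j x, V j x -> i <> j -> p i x = 0;
  proj_inj : forall x y, (forall i, p i x = p i y) -> x = y
}.

(** [p i x] is the component of index [i] in the decomposition of [x]. By uniqueness, exhibiting any
    decomposition computes it. *)
Lemma direct_sum_projections (R : zmodType) (I : Type) (V : I -> set R)
    (hV : forall i, additive_subgroup (V i)) :
  internal_direct_sum V -> exists p, direct_projections V p.
Proof.
move=> dV.
have [q qP] : {q : R -> I -> R & forall x, decomposes V x (q x)}.
  by apply: choice => x; have [f [fx _]] := dV x; exists f.
have qU x f : decomposes V x f -> q x = f.
  by move=> fx; have [g [_ gU]] := dV x; rewrite -(gU _ fx) -(gU _ (qP x)).
exists (fun i x => q x i); split=> [i x y|i x Vx|i j x Vx ij|x y qxy].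
- by rewrite (qU _ _ (decomposesB hV (qP x) (qP y))).
- by rewrite (qU _ _ (decomposes_single hV Vx)); case: asboolP.
- by rewrite (qU _ _ (decomposes_single hV Vx)); case: asboolP.
- have [_ _ ->] := qP x; have [_ _ ->] := qP y.
  by have -> : q x = q y by apply/funext.
Qed.

Lemma proj0 (R : zmodType) (I : Type) (V : I -> set R) (p : I -> R -> R) :
  direct_projections V p -> forall i, p i 0 = 0.
Proof. by move=> pP i; have := projB pP i 0 0; rewrite !subrr. Qed.

(** The kernel of [p i] is a subgroup that contains every [V j] with [j] in [P]. *)
Lemma proj_subgroup_sum (R : zmodType) (I : Type) (V : I -> set R)
    (p : I -> R -> R) (P : set I) (i : I) :
  direct_projections V p -> ~ P i ->
  forall x, subgroup_sum P V x -> p i x = 0.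
Proof.
move=> pP nPi; apply: (@subgroup_sum_sub _ _ _ _ [set x | p i x = 0]).
  split=> [|x y /= px py]; first exact: proj0 pP i.
  by rewrite (projB pP) px py subr0.
by move=> j Pj x Vx; apply: (proj_other pP Vx) => ij; apply: nPi; rewrite ij.
Qed.

(** The summands are indexed by a second type [J] and need not lie in the [V i], so that the sum can
    be a decomposition along a coarser family. *)
Lemma proj_fsum (R : zmodType) (I J : Type) (V : I -> set R)
    (p : I -> R -> R) (i : I) (j : J) (f : J -> R) :
  direct_projections V p -> finite_set [set k | f k != 0] ->
  (forall k, k <> j -> p i (f k) = 0) ->
  p i (\sum_(k \in [set: {classic J}]) f k) = p i (f j).
Proof.
move=> pP ff pf0.
have p0 := proj0 pP i.
have pD x y : p i (x + y) = p i x + p i y.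
  by rewrite -{1}[y]opprK (projB pP) -[- y]sub0r (projB pP) p0 sub0r opprK.
have /(@finite_fsetP {classic J}) [A AE] := ff.
have fA k : f k != 0 -> k \in A by move=> fk; rewrite -/([set` A] k) -AE.
rewrite (fsum_finite_support (A := A)) // (big_morph (p i) pD p0).
have [jA|jA] := boolP ((j : {classic J}) \in A).
  rewrite (big_fsetD1 (j : {classic J})) //= big_seq big1 ?addr0 // => k.
  by rewrite !inE => /andP[/eqP kj _]; exact: pf0.
(* Outside [A] the value [f j] is 0, so both sides vanish. *)
rewrite big_seq big1 => [|k kA].
  have [->|/fA] := eqVneq (f j) 0; first by rewrite p0.
  by rewrite (negPf jA).
by apply: pf0 => kj; rewrite -kj kA in jA.
Qed.

(* A decomposition along the coarser family is determined by its projections to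
   the finer one: [p i] only sees its component of index [F i]. *)
Lemma direct_sum_coarsen (R : zmodType) (I J : Type) (V : I -> set R)
    (F : I -> J) :
  (forall i, additive_subgroup (V i)) -> internal_direct_sum V ->
  internal_direct_sum (fun j => subgroup_sum [set i | F i = j] V).
Proof.
move=> hV dV; set W := (X in internal_direct_sum X) => x.
have [p pP] := direct_sum_projections hV dV.
have hW j : additive_subgroup (W j) by exact: subgroup_sum_subgroup.
have pW i j y : W j y -> F i <> j -> p i y = 0.
  by move=> Wy Fij; exact: (@proj_subgroup_sum _ _ _ _ [set k | F k = j] _ pP Fij).
have [f fx] : exists f, decomposes W x f.
  apply: (subgroup_sum_decomposes hW).
  (* Each [V i] lies in [W (F i)], so the [W j] generate as well. *)
  have := direct_sum_generates dV x; apply: subgroup_sum_sub => [|i _ y Vy].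
    exact: subgroup_sum_subgroup.
  apply: (@sub_subgroup_sum _ _ _ _ (F i)) => //.
  by apply: (@sub_subgroup_sum _ _ _ _ i).
have pf g i : decomposes W x g -> p i (g (F i)) = p i x.
  move=> [Wg fg ->]; rewrite (proj_fsum (j := F i) pP) // => j jF.
  by apply: (pW _ _ _ (Wg j)) => Fij; apply: jF.
exists f; split=> // g gx; apply/funext => j; apply: (proj_inj pP) => i.
(* Under [p i] both components become [p i x] if [F i = j], and 0 otherwise. *)
have [<-|Fij] := EM (F i = j); first by rewrite !pf.
by case: fx gx => [Wf _ _] [Wg _ _]; rewrite !(pW _ j).
Qed.

Lemma additive_subgroup0 (R : zmodType) : additive_subgroup [set 0 : R].
Proof. by split=> // x y /= -> ->; rewrite subrr. Qed.

Lemma nonzero_filter_witness (R : assocRingType) (C : category)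
    (V : mor C -> set R) :
  is_filter V -> nonzero_filter V -> forall s, exists2 x, V s x & x != 0.
Proof.
move=> [hV _ _] V0 s; apply: contrapT => nx; apply: (V0 s).
apply/seteqP; split=> [x Vx /=|_ ->]; last by case: (hV s).
by apply: contrapT => /eqP x0; apply: nx; exists x.
Qed.

(** * Prefunctors, functors and idempotents *)

Lemma comp_idm_l (C : category) (e : ob C) (s : mor C)
    (h : dom (idm e) = cod s) : comp h = s.
Proof.
have E : e = cod s by rewrite -h dom_idm.
by subst e; exact: comp_idl.
Qed.

(** The object map is recovered from the morphism map, as the domain of the image of [idm e]. *)
Lemma prefunctor_eq (C D : category) (F G : prefunctor C D) :
  pmor F =1 pmor G -> F = G.
Proof.
case: F => fo fm fd fc fx; case: G => go gm gd gc gx /= /funext E.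
subst gm; have Eo : fo = go.
  by apply/funext => e; rewrite -(dom_idm e) -fd -gd.
by subst go; congr Prefunctor; exact: Prop_irrelevance.
Qed.

Lemma functor_eq (C D : category) (F G : functor C D) :
  functor_prefunctor F = functor_prefunctor G -> F = G.
Proof.
case: F => F Fid; case: G => G Gid /= E; subst G.
by congr Functor; exact: Prop_irrelevance.
Qed.

(** Each [s] composes with the identities at its domain and codomain. Preservation of these two
    composites shows that [e] has to go to the domain of [f (idm e)]. *)
Lemma prefunctor_of_mor (C D : category) (f : mor C -> mor D) :
  (forall s t (st : dom s = cod t),
     exists fst : dom (f s) = cod (f t), f (comp st) = comp fst) ->
  exists F : prefunctor C D, pmor F = f.
Proof.
move=> fcomp.
have fd s : dom (f s) = dom (f (idm (dom s))).
  have h : dom s = cod (idm (dom s)) by rewrite cod_idm.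
  by have [fh fE] := fcomp _ _ h; rewrite -{1}(comp_idr h) fE dom_comp.
have fc s : cod (f s) = dom (f (idm (cod s))).
  have h : dom (idm (cod s)) = cod s by rewrite dom_idm.
  by have [fh _] := fcomp _ _ h.
have fx s t (st : dom s = cod t) (fst : dom (f s) = cod (f t)) :
    f (comp st) = comp fst.
  by have [fst' ->] := fcomp _ _ st; congr comp; exact: Prop_irrelevance.
by exists (@Prefunctor C D (fun e => dom (f (idm e))) f fd fc fx).
Qed.

Lemma prefunctor_functor (C D : category) (F : prefunctor C D) :
  only_trivial_idempotents D -> exists G : functor C D, functor_prefunctor G = F.
Proof.
move=> Did.
have Fid e : pmor F (idm e) = idm (pob F e).
  have ds : dom (pmor F (idm e)) = pob F e by rewrite pdom dom_idm.
  have cs : cod (pmor F (idm e)) = pob F e by rewrite pcod cod_idm.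
  apply: (Did _ _ ds cs).
  have ee : dom (@idm C e) = cod (@idm C e) by rewrite dom_idm cod_idm.
  by rewrite -(pcomp ee) comp_idm_l.
by exists (Functor Fid).
Qed.

(** If [s] is idempotent with inverse [t], then [s = (t s) s = t (s s) = t s], which is an
    identity. *)
Lemma groupoid_trivial_idempotents (C : category) :
  groupoid C -> only_trivial_idempotents C.
Proof.
move=> gC e s ds cs ss.
have [t [st [ts [_ tsE]]]] := gC s.
subst e.
have h1 : dom (comp ts) = cod s by rewrite dom_comp.
have h2 : dom t = cod (comp (etrans (erefl (dom s)) (esym cs))) by rewrite cod_comp.
have := compA h1 h2.
(* The composability proofs mention the composites being rewritten, so they are generalized
   first. *)
move: h1 h2; rewrite tsE ss => h1 h2; rewrite comp_idm_l => sE.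
by apply: (etrans sE); rewrite -tsE; congr comp; exact: Prop_irrelevance.
Qed.

(** * From elementary gradings to prefunctors *)

Lemma bijection_of_relation (A B : Type) (r : A -> B -> Prop) :
  (forall a, exists! b, r a b) -> (forall b, exists! a, r a b) ->
  exists f : A -> B, bijective f.
Proof.
move=> rA rB.
have [f fP] : {f : A -> B & forall a, r a (f a)}.
  by apply: choice => a; have [b [rab _]] := rA a; exists b.
have [g gP] : {g : B -> A & forall b, r (g b) b}.
  by apply: (@choice _ _ (fun b a => r a b)) => b; have [a [rab _]] := rB b; exists a.
(* Uniqueness on each side makes the two chosen maps mutually inverse. *)
exists f; exists g => [a|b].
  by have [a' [_ a'U]] := rB (f a); exact: etrans (esym (a'U _ (gP _))) (a'U _ (fP _)).
by have [b' [_ b'U]] := rA (g b); exact: etrans (esym (b'U _ (fP _))) (b'U _ (gP _)).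
Qed.

(** The correspondence is kept as a relation; choice turns it into a map only at the end. *)
Definition maps_into (R : assocRingType) (C D : category) (V : mor C -> set R)
    (W : mor D -> set R) (F : prefunctor C D) : Prop :=
  forall s, V s `<=` W (pmor F s).

(** For distinct [i] and [j] the projection [p i] would both fix [x] and kill it. *)
Lemma direct_sum_index_unique (R : zmodType) (I : Type) (W : I -> set R)
    (x : R) (i j : I) :
  (forall i, additive_subgroup (W i)) -> internal_direct_sum W ->
  x != 0 -> W i x -> W j x -> i = j.
Proof.
move=> hW dW x0 Wi Wj; have [p pP] := direct_sum_projections hW dW.
apply: contrapT => ij; move/eqP: x0; apply.
by rewrite -(proj_id pP Wi); exact: proj_other pP _ _ _ Wj ij.
Qed.

Lemma elementary_index (R : assocRingType) (C D : category)
    (V : mor C -> set R) (W : mor D -> set R) :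
  is_grading V -> nonzero_filter V -> is_grading W -> elementary V W ->
  forall s, exists t, V s `<=` W t.
Proof.
move=> [fV dV] V0 [fW dW] eW s; apply: contrapT => nt.
have [x Vx x0] := nonzero_filter_witness fV V0 s.
have [p pP] : exists p, direct_projections V p.
  by apply: direct_sum_projections dV; case: fV.
move/eqP: x0; apply; rewrite -(proj_id pP Vx).
have := direct_sum_generates dW x.
(* It suffices that [p s] kills each [W t]: this is a sum of components [V r] contained in [W t],
   and [V s] is not among them. *)
apply: (@subgroup_sum_sub _ _ _ _ [set y | p s y = 0]) => [|t _ y].
  by split=> [|u v /= pu pv]; rewrite /= ?(proj0 pP) // (projB pP) pu pv subr0.
rewrite eW; apply: (@proj_subgroup_sum _ _ _ _ [set r | V r `<=` W t] _ pP).
by move=> VsW; apply: nt; exists t.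
Qed.

Lemma elementary_grading_prefunctor (R : assocRingType) (C D : category)
    (V : mor C -> set R) (W : mor D -> set R) :
  is_grading V -> nonzero_filter V -> strong_filter V ->
  is_grading W -> elementary V W -> exists! F, maps_into V W F.
Proof.
move=> gV V0 sV gW eW; have [[hW Wc Wn] dW] := gW; have [fV dV] := gV.
have [f fP] := choice (elementary_index gV V0 gW eW).
have fU s t : V s `<=` W t -> f s = t.
  have [x Vx x0] := nonzero_filter_witness fV V0 s.
  by move=> VW; apply: (direct_sum_index_unique hW dW x0); [exact: fP | exact: VW].
have VVW s t : subgroup_mul (V s) (V t) `<=` subgroup_mul (W (f s)) (W (f t)).
  apply: subgroup_mul_sub => [|x y Vx Vy].
    exact: subgroup_mul_subgroup.
  by apply: mem_subgroup_mul; exact: fP.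
have [|F FE] := @prefunctor_of_mor C D f.
  move=> s t st; have [fst|nfst] := EM (dom (f s) = cod (f t)).
    exists fst; apply: fU; rewrite -sV; apply: subset_trans (VVW s t) _.
    exact: Wc.
  (* If the images were not composable, the nonzero [V (comp st)] would lie in a zero product. *)
  have [x] := nonzero_filter_witness fV V0 (comp st).
  by rewrite -sV => /VVW; rewrite Wn // => -> /eqP.
exists F; split=> [s|G GP]; first by rewrite FE; exact: fP.
by apply: prefunctor_eq => s; rewrite FE; exact: fU.
Qed.

(** * From prefunctors to elementary gradings *)

Definition pushforward (R : assocRingType) (C D : category)
    (V : mor C -> set R) (F : prefunctor C D) (t : mor D) : set R :=
  subgroup_sum [set s | pmor F s = t] V.

Lemma pushforward_filter (R : assocRingType) (C D : category)
    (V : mor C -> set R) (F : prefunctor C D) :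
  is_filter V -> is_filter (pushforward V F).
Proof.
move=> [hV Vc Vn]; split=> [t|t u tu|t u ntu].
- exact: subgroup_sum_subgroup.
- apply: subgroup_mul_sub; first exact: subgroup_sum_subgroup.
  apply: subgroup_sum_rmul; first exact: subgroup_sum_subgroup.
  move=> r s x y /= Fr Fs Vx Vy; subst t u.
  have := mem_subgroup_mul Vx Vy.
  (* [F] may identify objects, so [r] and [s] need not be composable although their images are;
     their product is then 0. *)
  have [rs|nrs] := EM (dom r = cod s); last first.
    by rewrite Vn // => ->; case: (subgroup_sum_subgroup [set q | pmor F q = comp tu] V).
  by move=> /(Vc _ _ rs); apply: sub_subgroup_sum; exact: pcomp.
- apply/seteqP; split.
    apply: subgroup_mul_sub; first exact: additive_subgroup0.
    apply: subgroup_sum_rmul; first exact: additive_subgroup0.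
    move=> r s x y Fr Fs Vx Vy; rewrite -(Vn r s); first exact: mem_subgroup_mul.
    by move=> rs; apply: ntu; rewrite -Fr -Fs pdom pcod rs.
  by move=> _ ->; case: (@subgroup_mul_subgroup R (pushforward V F t) (pushforward V F u)).
Qed.

Lemma pushforward_grading (R : assocRingType) (C D : category)
    (V : mor C -> set R) (F : prefunctor C D) :
  is_grading V -> is_grading (pushforward V F).
Proof.
move=> [fV dV]; split; first exact: pushforward_filter.
by apply: direct_sum_coarsen => //; case: fV.
Qed.

Lemma maps_into_pushforward (R : assocRingType) (C D : category)
    (V : mor C -> set R) (F : prefunctor C D) :
  maps_into V (pushforward V F) F.
Proof. by move=> s; exact: sub_subgroup_sum. Qed.

(** A nonzero element of [V s] lies in only one [W t]. Thus the index set in [elementary] is a fibre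
    of [F], and an elementary [W] is the pushforward. *)
Lemma maps_into_index (R : assocRingType) (C D : category)
    (V : mor C -> set R) (W : mor D -> set R) (F : prefunctor C D) :
  is_filter V -> nonzero_filter V -> is_grading W -> maps_into V W F ->
  forall t, [set s | V s `<=` W t] = [set s | pmor F s = t].
Proof.
move=> fV V0 [[hW _ _] dW] VWF t; apply/seteqP; split=> [s /= VW|s /= <-//].
have [x Vx x0] := nonzero_filter_witness fV V0 s.
by apply: (direct_sum_index_unique hW dW x0); [exact: VWF | exact: VW].
Qed.

Lemma prefunctor_elementary_grading (R : assocRingType) (C D : category)
    (V : mor C -> set R) (F : prefunctor C D) :
  is_grading V -> nonzero_filter V ->
  exists! W : elementary_grading V D, maps_into V (sval W) F.
Proof.
move=> gV V0; have [fV _] := gV.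
have gW := pushforward_grading F gV.
have eW : elementary V (pushforward V F).
  by move=> t; rewrite (maps_into_index fV V0 gW (@maps_into_pushforward R C D V F)).
exists (exist (fun W => is_grading W /\ elementary V W) _ (conj gW eW)); split=> [|[W [gW' eW']] /= VWF].
  exact: maps_into_pushforward.
apply: eq_exist => /=; apply/funext => t.
by rewrite [RHS]eW' (maps_into_index fV V0 gW' VWF).
Qed.

(** * The bijections with prefunctors and with functors *)

Theorem theorem5 (Gamma Lambda : category) (R : assocRingType)
    (V : mor Gamma -> set R)
    (hV : is_grading V) (hV0 : nonzero_filter V) (hVs : strong_filter V) :
  (exists f : elementary_grading V Lambda -> prefunctor Gamma Lambda,
     bijective f) /\
  (only_trivial_idempotents Lambda ->
   exists f : elementary_grading V Lambda -> functor Gamma Lambda,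
     bijective f) /\
  (groupoid Lambda ->
   exists f : elementary_grading V Lambda -> functor Gamma Lambda,
     bijective f).
Proof.
have WF (W : elementary_grading V Lambda) : exists! F, maps_into V (sval W) F.
  by case: W => W [gW eW]; exact: elementary_grading_prefunctor.
have FW F : exists! W : elementary_grading V Lambda, maps_into V (sval W) F.
  exact: prefunctor_elementary_grading.
have functor_bij : only_trivial_idempotents Lambda ->
    exists f : elementary_grading V Lambda -> functor Gamma Lambda, bijective f.
  move=> Lid.
  apply: (@bijection_of_relation _ _ (fun W (G : functor Gamma Lambda) =>
    maps_into V (sval W) (functor_prefunctor G))).
    (* The unique prefunctor attached to [W] is a functor, and equality of functors is that of their
       prefunctors. *)
    move=> W; have [F [VWF FU]] := WF W.
    have [G GF] := prefunctor_functor F Lid.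
    exists G; split=> [|G' /FU FG']; first by rewrite GF.
    by apply: functor_eq; rewrite GF.
  by move=> G; exact: FW.
split; last by split=> // /groupoid_trivial_idempotents.
exact: bijection_of_relation WF FW.
Qed.
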